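(* Every connected $\delta$-hyperbolic fine graph $\Gamma$ is alternatively hyperbolic.
   Context: Graphs are without loops and multiple edges; $\Gamma^0,\Gamma^1$ are the sets of vertices and edges. An arc is a finite simple path. A graph is fine if each set of arcs of bounded length with fixed endpoints is finite. $\delta$-hyperbolicity is Gromov hyperbolicity of the graph with its path metric. For an edge $e$ let $\mathbf u_e$ be the set of unordered pairs $\{x,y\}$ of (possibly equal) vertices such that no geodesic segment joining $x$ and $y$ passes through $e$, and for a finite set $F$ of edges let $\mathbf u_F=\bigcap_{f\in F}\mathbf u_f$. For a set $\mathbf u$ of unordered pairs containing all pairs $\{x,x\}$, $\mathbf u^2$ is the set of pairs $\{x,y\}$ such that $\{x,z\},\{z,y\}\in\mathbf u$ for some vertex $z$. The visibility filter $\mathrm{Vis}\,\Gamma$ is the filter on the set of unordered pairs of vertices generated by $\{\mathbf u_e:e\in\Gamma^1\}$. A connected graph $\Gamma$ is alternatively hyperbolic if $\mathrm{Vis}\,\Gamma$ is a uniformity on $\Gamma^0$, i.e. for every $e\in\Gamma^1$ there is a finite set $F\subset\Gamma^1$ with $\mathbf u_F^2\subset\mathbf u_e$. *)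

(* Defs.v *)
From HB Require Import structures.
From mathcomp Require Import all_boot all_order all_algebra.
From mathcomp Require Import boolp classical_sets cardinality filter reals.

Set Implicit Arguments.
Unset Strict Implicit.
Unset Printing Implicit Defensive.
Import Order.TTheory GRing.Theory Num.Theory.

Local Open Scope classical_set_scope.
Local Open Scope ring_scope.

(* The vertex set may be infinite, and no local finiteness is assumed. *)
Record graph (V : choiceType) := Graph {
  adj :> rel V;
  adj_sym : symmetric adj;
  adj_irrefl : irreflexive adj
}.

(* Unordered pairs {x, y}, with x = y allowed. *)
Definition upair (V : Type) := {A : set V | exists x y, A = [set x; y]}.

Definition mkupair (V : Type) (x y : V) : upair V :=
  exist _ [set x; y] (ex_intro _ x (ex_intro _ y erefl)).

HB.instance Definition _ (V : Type) := gen_eqMixin (upair V).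
HB.instance Definition _ (V : Type) := gen_choiceMixin (upair V).

Section UnorderedPairs.
Context {V : Type}.
Implicit Types x y z : V.

Lemma mkupair_surj (p : upair V) : exists x y, p = mkupair x y.
Proof.
case: p => A [x [y Axy]]; exists x, y; subst A.
by congr exist; exact: Prop_irrelevance.
Qed.

Lemma mkupairC x y : mkupair x y = mkupair y x.
Proof. by apply: eq_exist; rewrite /= setUC. Qed.

Lemma mkupair_eq x y x' y' : mkupair x y = mkupair x' y' <->
  (x = x' /\ y = y') \/ (x = y' /\ y = x').
Proof.
split; last by case=> -[-> ->] //; exact: mkupairC.
move/(congr1 sval) => /= E.
have hx : [set x'; y'] x by rewrite -E; left.
have hy : [set x'; y'] y by rewrite -E; right.
have hx' : [set x; y] x' by rewrite E; left.
have hy' : [set x; y] y' by rewrite E; right.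
by case: hx hy hx' hy' => -> [] -> [] ? [] ?; subst; auto.
Qed.

End UnorderedPairs.

Section Graphs.
Context {V : choiceType}.
Variable G : graph V.
Implicit Types (x y z : V) (p : seq V).

Definition edges : set (upair V) :=
  [set e | exists x y, adj G x y /\ e = mkupair x y].

(* The walk with vertex sequence x :: p, hence of length size p. *)
Definition walk x y p : bool := path (adj G) x p && (last x p == y).

Definition walk_edges x p : seq (upair V) := pairmap (@mkupair V) x p.

Definition arc x y p : bool := walk x y p && uniq (x :: p).

Definition connected : Prop := forall x y, exists p, walk x y p.

Definition fine : Prop :=
  forall x y (n : nat), finite_set [set p | arc x y p /\ (size p <= n)%N].

(* The path metric; it takes the junk value 0 when no walk joins x and y. *)
Definition dist x y : nat :=
  xget 0%N [set n : nat | (exists2 p, walk x y p & size p = n) /\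
                          (forall p, walk x y p -> (n <= size p)%N)].

Definition geodesic x y p : Prop := walk x y p /\ size p = dist x y.

Definition gromov_product (R : realType) (w x y : V) : R :=
  ((dist x w)%:R + (dist y w)%:R - (dist x y)%:R) / 2.

(* The four-point condition on the vertex set with the path metric; slim
   triangles or the geometric realization only change the value of delta. *)
Definition hyperbolic (R : realType) (delta : R) : Prop :=
  forall w x y z : V,
    Num.min (gromov_product R w x y) (gromov_product R w y z) - delta
      <= gromov_product R w x z.

(* The pairs {x, y} such that no geodesic from x to y passes through e. *)
Definition unseen (e : upair V) : set (upair V) :=
  [set q | forall x y p, q = mkupair x y -> geodesic x y p ->
                         e \notin walk_edges x p].

Definition unseen_set (F : set (upair V)) : set (upair V) :=
  \bigcap_(f in F) unseen f.

(* The filter on the set of unordered pairs generated by the unseen e. *)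
Definition visibility : set_system (upair V) :=
  smallest (fun W : set_system (upair V) => Filter W) [set unseen e | e in edges].

End Graphs.

Definition usquare (V : Type) (u : set (upair V)) : set (upair V) :=
  [set q | exists x y z,
     [/\ q = mkupair x y, u (mkupair x z) & u (mkupair z y)]].

(* A uniformity, its entourages being sets of unordered pairs (so that the
   symmetry axiom is built in); it need not be separated. *)
Definition is_uniformity (V : Type) (W : set_system (upair V)) : Prop :=
  [/\ Filter W,
      forall u, W u -> forall x, u (mkupair x x)
    & forall u, W u -> exists2 v, W v & usquare v `<=` u].

Definition alternatively_hyperbolic (V : choiceType) (G : graph V) : Prop :=
  is_uniformity (visibility G).

Section Visibility.
Context {V : choiceType}.
Variable G : graph V.

Lemma dist_spec x y : (exists p, walk G x y p) ->
  (exists2 p, walk G x y p & size p = dist G x y) /\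
  (forall p, walk G x y p -> (dist G x y <= size p)%N).
Proof.
move=> [p0 wp0]; rewrite /dist.
apply: (@xgetPex _ 0%N [set n : nat | (exists2 p, walk G x y p & size p = n) /\
                          (forall p, walk G x y p -> (n <= size p)%N)]).
have ex : exists n, `[< exists2 p, walk G x y p & size p = n >].
  by exists (size p0); apply/asboolP; exists p0.
exists (ex_minn ex); case: ex_minnP => m /asboolP hm min; split => // p wp.
by apply: min; apply/asboolP; exists p.
Qed.

Lemma unseen_diag e x : unseen G e (mkupair x x).
Proof.
move=> a b p /mkupair_eq E.
have {E}[-> ->] : a = x /\ b = x by case: E => -[-> ->].
have wx : walk G x x [::] by rewrite /walk /= eqxx.
have [_ /(_ _ wx)] := dist_spec (ex_intro _ [::] wx).
by rewrite leqn0 => /eqP d0 [_]; rewrite d0 => /size0nil ->.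
Qed.

Lemma visibilityP (U : set (upair V)) : visibility G U <->
  exists F, [/\ finite_set F, F `<=` edges G & unseen_set G F `<=` U].
Proof.
split.
  apply: (smallest_sub (X := [set U | exists F,
    [/\ finite_set F, F `<=` edges G & unseen_set G F `<=` U]])).
    split.
    - by exists set0; split.
    - move=> A B [F [fF sF FA]] [F' [fF' sF' FB]]; exists (F `|` F'); split.
      + by rewrite finite_setU.
      + by move=> e [/sF|/sF'].
      + by move=> q hq; split; [apply: FA|apply: FB] => f Ff; apply: hq;
          [left|right].
    - move=> P Q PQ [F [fF sF FP]]; exists F; split=> //.
      exact: subset_trans PQ.
  move=> _ [e Ge <-]; exists [set e]; split=> //.
  - by move=> _ ->.
  - by move=> q; apply.
move=> [F [fF sF FU]] W [FW sW].
have WF : W (unseen_set G F).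
  have [D FD] := iffLR finite_fsetP fF; rewrite /unseen_set FD.
  apply: filter_bigI => f Df; have Ff : F f by rewrite FD.
  by apply: sW; exists f => //; exact: sF.
exact: filterS WF.
Qed.

Lemma alternatively_hyperbolicP : alternatively_hyperbolic G <->
  forall e, edges G e ->
    exists F, [/\ finite_set F, F `<=` edges G &
                  usquare (unseen_set G F) `<=` unseen G e].
Proof.
split.
  move=> [_ _ H] e Ge.
  have /H[v /visibilityP[F [fF sF Fv]] vu] : visibility G (unseen G e).
    by apply/visibilityP; exists [set e]; split=> // [_ ->|q]//; apply.
  exists F; split=> // q [x [y [z [-> /Fv h1 /Fv h2]]]].
  by apply: vu; exists x, y, z.
move=> H; split.
- split.
  + by apply/visibilityP; exists set0; split.
  + by move=> A B hA hB W hW; case: (hW) => FW _; apply: filterI;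
      [exact: hA|exact: hB].
  + by move=> P Q PQ hP W hW; case: (hW) => FW _; apply: filterS PQ _; exact: hP.
- by move=> u /visibilityP[F [_ _ Fu]] x; apply: Fu => f _; exact: unseen_diag.
- move=> u /visibilityP[F [fF sF Fu]].
  have /choice[K HK] : forall e, exists K, F e -> [/\ finite_set K,
      K `<=` edges G & usquare (unseen_set G K) `<=` unseen G e].
    move=> e; have [Fe|nFe] := pselect (F e); last by exists set0.
    by have [K HK] := H e (sF _ Fe); exists K.
  exists (unseen_set G (\bigcup_(e in F) K e)).
    apply/visibilityP; exists (\bigcup_(e in F) K e); split=> //.
    + by apply: bigcup_finite => // e /HK[].
    + by move=> k [e /HK[_ sK _]] /sK.
  move=> q [x [y [z [-> h1 h2]]]]; apply: Fu => e Fe.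
  have [_ _] := HK e Fe; apply; exists x, y, z; split=> // k Kk.
  + by apply: h1; exists e.
  + by apply: h2; exists e.
Qed.

End Visibility.

(* Main.v *)
Require Import Defs.
From mathcomp Require Import all_boot all_order all_algebra.
From mathcomp Require Import boolp classical_sets cardinality filter reals.
From mathcomp Require Import zify lra.

(** Let [e = ab] be an edge, and let [F] be the set of edges lying on arcs
of length at most [N] between [a] and [b]; fineness makes [F] finite.  For [N]
large in terms of [delta], a geodesic triangle one of whose sides runs through
[e] has an edge of [F] on another side, which is alternative hyperbolicity.

The finite set [F] is exploited by a cut argument ([no_short_reach]): if [P] is
a set of vertices containing [a] but not [b], every walk from [a] to [b] of
length at most [N] crosses the boundary of [P] along an edge of [F], since it
can be shortened to an arc.  Let [x, y, z] be a triangle such that a geodesic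
from [x] to [y] passes through [a] and then [b], and suppose that no geodesic
from [x] to [z] or from [z] to [y] uses [F].  Taking for [P] the ball around [x]
of radius [dist x a], a contradiction arises from a short walk from [a] to [b]
which crosses the boundary of [P] only along those two sides.

The walk goes around [e] ([no_cut_triangle]).  Move away from [e] along the side
[xy] by the thinness constant [D], backwards from [a] to [p] and forwards from
[b] to [q], stopping at [x] or [y] if the side is too short.  Up to exchanging
the roles of [x] and [y], [p] is close to a point [p'] of the side [xz].  If
[q] is close to a point [q'] of the same side, walk from [p'] to [q'] along it.
Otherwise [q] is close to a point [q'] of [zy]; then follow [xz] from [p'] up to
a point [c] beyond distance [dist x a + D] from [x] (or up to [z]), jump to the
corresponding point [c'] of [zy], and walk on to [q'].  The displacements by
[D] ensure that the jumps [pp'], [cc'] and [qq'] stay on one side of the boundary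
of [P]. *)

Set Implicit Arguments.
Unset Strict Implicit.
Unset Printing Implicit Defensive.
Import Order.TTheory GRing.Theory Num.Theory.

Local Open Scope classical_set_scope.

Section Walks.
Context {V : choiceType}.
Implicit Types (r : rel V) (x y z : V) (p : seq V).

Lemma path_stepP r x p :
  (forall p1 y p2, p = p1 ++ y :: p2 -> r (last x p1) y) <-> path r x p.
Proof.
split; last by move=> rp p1 y p2 E; move: rp; rewrite E cat_path => /= /and3P[].
elim: p x => //= y p IH x step; apply/andP; split; first exact: (step [::] y p).
by apply: IH => p1 z p2 E; apply: (step (y :: p1) z p2); rewrite E.
Qed.

Lemma walk_edgesP (f : upair V) x p : f \in walk_edges x p <->
  exists p1 y p2, p = p1 ++ y :: p2 /\ f = mkupair (last x p1) y.
Proof.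
split; last first.
  by move=> [p1 [y [p2 [-> ->]]]]; rewrite /walk_edges pairmap_cat /=
    mem_cat inE eqxx orbT.
elim: p x => //= y p IH x; rewrite inE => /orP[/eqP ->|/IH].
  by exists [::], y, p.
by move=> [p1 [z [p2 [-> ->]]]]; exists (y :: p1), z, p2.
Qed.

Definition reach r (n : nat) x y : Prop :=
  exists p, [/\ path r x p, last x p = y & (size p <= n)%N].

Lemma reach_trans r m n y x z :
  reach r m x y -> reach r n y z -> reach r (m + n) x z.
Proof.
move=> [p [rp lp sp]] [q [rq lq sq]]; exists (p ++ q); split.
- by rewrite cat_path rp lp.
- by rewrite last_cat lp.
- by rewrite size_cat leq_add.
Qed.

Lemma reach_le r m n x y : (m <= n)%N -> reach r m x y -> reach r n x y.
Proof. by move=> mn [p [? ? sp]]; exists p; split=> //; exact: leq_trans mn. Qed.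

Lemma reach_sym r n x y : symmetric r -> reach r n x y -> reach r n y x.
Proof.
move=> rC [p [rp lp sp]]; exists (rev (belast x p)); split.
- by rewrite -lp rev_path; under eq_path do rewrite rC.
- by case: p lp {rp sp} => //= z p lp; rewrite rev_cons last_rcons.
- by rewrite size_rev size_belast.
Qed.

End Walks.

(** * The path metric of a connected graph *)

Section Metric.
Context {V : choiceType}.
Variable G : graph V.
Hypothesis Gconn : connected G.
Implicit Types (u v w x y z : V) (p : seq V).

Let d := dist G.

Lemma dist_le_size x y p : walk G x y p -> (d x y <= size p)%N.
Proof. by move: p; case: (dist_spec (Gconn x y)). Qed.

Lemma geodesic_exists x y : exists p, geodesic G x y p.
Proof. by have [[p wp sp] _] := dist_spec (Gconn x y); exists p. Qed.

Lemma dist_triangle y x z : (d x z <= d x y + d y z)%N.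
Proof.
have [p [/andP[pp /eqP lp] sp]] := geodesic_exists x y.
have [q [/andP[pq /eqP lq] sq]] := geodesic_exists y z.
rewrite /d -sp -sq -size_cat; apply: dist_le_size.
by rewrite /walk cat_path pp lp pq last_cat lp lq eqxx.
Qed.

Lemma distC x y : d x y = d y x.
Proof.
suff le u v : (d u v <= d v u)%N by apply/eqP; rewrite eqn_leq !le.
have [p [/andP[pp /eqP lp] sp]] := geodesic_exists v u.
have [q [pq lq sq]] : reach (adj G) (d v u) u v.
  by apply: reach_sym; [exact: adj_sym|exists p; rewrite sp].
by apply: leq_trans sq; apply: dist_le_size; rewrite /walk pq lq /=.
Qed.

Lemma dist_adj x y : adj G x y -> (d x y <= 1)%N.
Proof.
move=> xy; apply: (@dist_le_size x y [:: y]).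
by rewrite /walk /= xy eqxx.
Qed.

(** Along a geodesic all triangle inequalities between its ends and a step are
equalities, so steps of geodesics have a purely metric description. *)
Lemma geodesic_step x y p1 v p2 : geodesic G x y (p1 ++ v :: p2) ->
  adj G (last x p1) v /\ (d x (last x p1) + 1 + d v y = d x y)%N.
Proof.
move=> [/andP[+ /eqP +] +]; rewrite cat_path last_cat size_cat /=.
set u := last x p1 => /and3P[pp1 uv pp2] lp sp; split=> //.
have h1 : (d x u <= size p1)%N by apply: dist_le_size; rewrite /walk pp1 /=.
have h2 : (d v y <= size p2)%N by apply: dist_le_size; rewrite /walk pp2 lp /=.
have h3 := dist_adj uv; have h4 := dist_triangle u x y.
have h5 := dist_triangle v u y; rewrite -/d in sp; lia.
Qed.

Lemma step_geodesic x y u v :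
  adj G u v -> (d x u + 1 + d v y = d x y)%N ->
  exists2 p, geodesic G x y p & mkupair u v \in walk_edges x p.
Proof.
move=> uv E.
have [p [/andP[pp /eqP lp] sp]] := geodesic_exists x u.
have [q [/andP[pq /eqP lq] sq]] := geodesic_exists v y.
exists (p ++ v :: q).
  split; last by rewrite size_cat /= sp sq -/(d x y) -E /d; lia.
  by rewrite /walk cat_path last_cat pp lp /= uv pq lq eqxx.
by apply/walk_edgesP; exists p, v, q; rewrite lp.
Qed.

Lemma unseen_distP u v x y : adj G u v ->
  unseen G (mkupair u v) (mkupair x y) <->
  (d x u + 1 + d v y <> d x y)%N /\ (d x v + 1 + d u y <> d x y)%N.
Proof.
move=> uv; split.
  move=> H; split=> [|E].
    move/(step_geodesic uv) => [p gp]; apply/negP; exact: H gp.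
  have vu : adj G v u by rewrite adj_sym.
  have [p gp] := step_geodesic vu E.
  by rewrite mkupairC; apply/negP; exact: H gp.
move=> [H1 H2] x' y' p /mkupair_eq E gp; apply/negP.
move=> /walk_edgesP[p1 [t [p2 [Ep /mkupair_eq Euv]]]].
move: gp; rewrite Ep => /geodesic_step[_].
move: (last x' p1) Euv => s Euv.
have C1 := distC x u; have C2 := distC x v; have C3 := distC y u.
have C4 := distC y v; have C5 := distC x y.
by case: E => -[? ?]; case: Euv => -[? ?]; subst; lia.
Qed.

Lemma dist_interpolate x y t : (t <= d x y)%N ->
  exists2 u, d x u = t & (d u y = d x y - t)%N.
Proof.
move=> tn; have [p [/andP[+ /eqP +] sp]] := geodesic_exists x y.
rewrite -{1 2}(cat_take_drop t p) cat_path last_cat.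
set u := last x (take t p) => /andP[p1 p2] lp.
have h1 : (d x u <= t)%N.
  apply: leq_trans (dist_le_size (p := take t p) _) _; first by rewrite /walk p1 /=.
  by rewrite size_take sp -/(d x y); case: ifP; lia.
have h2 : (d u y <= d x y - t)%N.
  apply: leq_trans (dist_le_size (p := drop t p) _) _.
    by rewrite /walk p2 lp /=.
  by rewrite size_drop sp.
by have h3 := dist_triangle u x y; exists u; lia.
Qed.

Lemma reach_geodesic (r : rel V) x y :
  (forall s t, adj G s t -> (d x s + 1 + d t y = d x y)%N -> r s t) ->
  reach r (d x y) x y.
Proof.
move=> H; have [p gp] := geodesic_exists x y.
have [/andP[_ /eqP lp] sp] := gp.
exists p; split=> //; last by rewrite sp.
apply/path_stepP => p1 v p2 E; move: gp; rewrite E => /geodesic_step[adjv].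
exact: H.
Qed.

(** Two sides of a triangle issued from [x] stay [4 delta]-close up to the
Gromov product at [x] of the other two vertices: apply the four-point condition
along [u, y, z, v]. *)
Lemma hyperbolic_fellow_travel (R : realType) (delta : R) :
  hyperbolic G delta ->
  exists D : nat, forall x y z u v,
    (d x u + d u y = d x y)%N -> (d x v + d v z = d x z)%N -> d x u = d x v ->
    (2 * d x u + d y z <= d x y + d x z)%N -> (d u v <= D)%N.
Proof.
move=> hyp; have [D hD] : exists D : nat, (4 * delta <= D%:R)%R.
  exists (Num.bound `|4 * delta|%R).
  by apply: le_trans (ler_norm _) _; exact/ltW/archi_boundP/normr_ge0.
exists D => x y z u v xuy xvz uv le_prod.
have := hyp x u y z; have := hyp x u z v; have := hyp x x x x.
rewrite /gromov_product -/d !minEle.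
rewrite (distC u x) (distC y x) (distC z x) (distC v x) (distC z v).
move: xuy xvz uv le_prod => /(congr1 (fun n : nat => n%:R%R : R)).
rewrite natrD => xuy /(congr1 (fun n : nat => n%:R%R : R)).
rewrite natrD => xvz /(congr1 (fun n : nat => n%:R%R : R)) uv.
rewrite -(ler_nat R) [((d x y + _)%:R)%R]natrD natrD natrM => le_prod h0 h1 h2.
rewrite -(ler_nat R).
by move: h0 h1 h2; do !case: ifP; lra.
Qed.

End Metric.

(** * Cuts by short arcs *)

Section Cuts.
Context {V : choiceType}.
Variable G : graph V.
Implicit Types (a b x y : V) (F : set (upair V)) (P : pred V).

Definition short_arc_edges a b (n : nat) : set (upair V) :=
  \bigcup_(p in [set p | Defs.arc G a b p /\ (size p <= n)%N])
    [set` walk_edges a p].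

Lemma finite_short_arc_edges a b n :
  fine G -> finite_set (short_arc_edges a b n).
Proof. by move=> fG; apply: bigcup_finite => // p _; exact: finite_seq. Qed.

Lemma short_arc_edges_sub a b n : short_arc_edges a b n `<=` edges G.
Proof.
move=> f [p [/andP[/andP[/path_stepP pp _] _] _]] /walk_edgesP.
by move=> [p1 [y [p2 [E ->]]]]; exists (last a p1), y; split; first exact: pp E.
Qed.

(** Both kinds of steps of the detour: those along the sides of the triangle,
which avoid [F] but may cross the cut, and those of the jumps, which may use [F]
but do not cross the cut. *)
Definition cut_step F P : rel V := [rel x y |
  adj G x y && ((P x == P y) || `[< ~ F (mkupair x y) >])].

Lemma cut_step_sym F P : symmetric (cut_step F P).
Proof. by move=> x y; rewrite /cut_step /= adj_sym eq_sym mkupairC. Qed.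

(** A walk from [a] to [b] of length at most [n] contains an arc, all of whose
edges belong to [short_arc_edges a b n]; one of them leaves [P]. *)
Lemma no_short_reach a b n P : P a -> ~~ P b ->
  ~ reach (cut_step (short_arc_edges a b n) P) n a b.
Proof.
move=> Pa Pb [p0 [pp0]]; case: (shortenP pp0) => p pp up sub lp sp0.
have arcp : Defs.arc G a b p.
  rewrite /Defs.arc up /walk lp eqxx !andbT.
  by apply: sub_path pp => x y /andP[].
have sp : (size p <= n)%N.
  apply: leq_trans sp0; apply: uniq_leq_size; last exact: sub.
  by case/andP: up.
suff : path [rel x y | P x == P y] a p.
  move=> pP; suff E : P (last a p) = P a by rewrite -lp E Pa in Pb.
  by elim: p a pP {Pa pp0 pp up sub lp arcp sp} => //= y p IH a
    /andP[/eqP -> /IH].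
apply/path_stepP => p1 y p2 E; move/path_stepP: pp => /(_ _ _ _ E).
case/andP=> _ /orP[//|/asboolP[]]; exists p => //.
by apply/walk_edgesP; exists p1, y, p2.
Qed.

Section Reach.
Hypothesis Gconn : connected G.
Let d := dist G.

Lemma reach_unseen F P x z u v : unseen_set G F (mkupair x z) ->
  (d x u + d u v + d v z = d x z)%N -> reach (cut_step F P) (d u v) u v.
Proof.
move=> uns E; apply: reach_geodesic => // s t st.
rewrite -/d => Est; rewrite /cut_step /= st.
apply/orP; right; apply/asboolP => /uns /(unseen_distP Gconn _ _ st)[+ _].
have h1 := dist_triangle Gconn u x s; have h2 := dist_triangle Gconn v t z.
have h3 := dist_triangle Gconn s x z; have h4 := dist_triangle Gconn t s z.
have := dist_adj Gconn st; rewrite -!/d in h1 h2 h3 h4 *; lia.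
Qed.

Lemma reach_const F P u v :
  (forall w, (d u w + d w v = d u v)%N -> P w = P u) ->
  reach (cut_step F P) (d u v) u v.
Proof.
move=> HP; apply: reach_geodesic => // s t st.
rewrite -/d => Est; rewrite /cut_step /= st.
have h1 := dist_triangle Gconn s u v; have h2 := dist_triangle Gconn t s v.
have h3 := dist_triangle Gconn t u v; have h4 := dist_triangle Gconn s u t.
have h5 := dist_adj Gconn st; rewrite -!/d in h1 h2 h3 h4 h5.
by rewrite !HP ?eqxx //; lia.
Qed.

End Reach.
End Cuts.

(** * Triangles with a side through a given edge *)

Section Triangles.
Context {V : choiceType}.
Variable G : graph V.
Hypothesis Gconn : connected G.
Let d := dist G.
Variable D : nat.
Hypothesis thin : forall x y z u v,
  (d x u + d u y = d x y)%N -> (d x v + d v z = d x z)%N -> d x u = d x v ->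
  (2 * d x u + d y z <= d x y + d x z)%N -> (d u v <= D)%N.

(** The walk around the edge that contradicts the cut property.  The last
hypothesis says that [p], the point of [xy] at distance [D] before [a] (or [x]
if there is none), is not beyond the internal point of the triangle on [xy], so
that [p] is close to the side [xz].  The constant [14 * D + 3] is the total
length of the longest detour. *)
Lemma no_cut_triangle a b x y z :
  let F := short_arc_edges G a b (14 * D + 3) in
  adj G a b -> (d x a + 1 + d b y = d x y)%N ->
  unseen_set G F (mkupair x z) -> unseen_set G F (mkupair z y) ->
  (2 * (d x a - D) + d y z <= d x y + d x z)%N -> False.
Proof.
move=> F ab Exy unsx unsy le_p.
have tri u v w : (d u w <= d u v + d v w)%N := dist_triangle Gconn v u w.
have dC u v : d u v = d v u := distC Gconn u v.
have dab : (d a b <= 1)%N := dist_adj Gconn ab.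
pose P w := (d x w <= d x a)%N.
have Pa : P a by rewrite /P.
have xb : d x b = (d x a + 1)%N.
  by have := tri x a b; have := tri x b y; lia.
have ya : d y a = (d b y + 1)%N.
  by have := tri y b a; have := tri x a y; rewrite !(dC y) (dC b a); lia.
have Pb : ~~ P b by rewrite /P xb; lia.
apply: (no_short_reach (n := 14 * D + 3) Pa Pb); rewrite -/F.
have rC m u v : reach (cut_step G F P) m u v -> reach (cut_step G F P) m v u.
  exact/reach_sym/cut_step_sym.
have [p xp pa] : exists2 p, d x p = (d x a - D)%N &
    (d p a = d x a - (d x a - D))%N.
  by apply: dist_interpolate => //; exact: leq_subr.
have xpy : (d x p + d p y = d x y)%N.
  by have := tri x p y; have := tri p a y; rewrite (dC a y); lia.
have [q yq qb] : exists2 q, d y q = (d b y - D)%N &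
    (d q b = d b y - (d b y - D))%N.
  by rewrite (dC b y); apply: dist_interpolate => //; exact: leq_subr.
have yqx : (d y q + d q x = d y x)%N.
  by have := tri y q x; have := tri q b x; rewrite (dC b x) (dC y x); lia.
have r_ap : reach (cut_step G F P) D a p.
  apply: rC; apply: (@reach_le _ _ (d p a)); first by lia.
  apply: reach_const => // w Ew; rewrite /P.
  by have := tri x p w; have := tri p w a; rewrite -!/d in Ew *; lia.
have r_qb : reach (cut_step G F P) D q b.
  apply: (@reach_le _ _ (d q b)); first by lia.
  apply: reach_const => // w Ew; rewrite /P.
  have := tri x w q; rewrite (dC w q) -!/d in Ew *.
  by move: yqx; rewrite (dC y x) (dC q x); lia.
(* This jump is trivial if p = x; otherwise p is at distance D from a, and the
   jump is too short to leave the ball P. Similarly for the jump at q below. *)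
have r_pp' p' : d x p' = d x p -> (d p p' <= D)%N ->
    reach (cut_step G F P) D p p'.
  move=> Ep' lep'; apply: (reach_le lep').
  apply: reach_const => // w Ew; rewrite /P -!/d in Ew *.
  by have := tri x p w; have := tri p x p'; rewrite (dC p x); lia.
have r_qq' q' : (d q q' <= D)%N -> (d q q' <= d q b)%N ->
    reach (cut_step G F P) D q' q.
  move=> leq' leq2; apply: rC; apply: (reach_le leq').
  apply: reach_const => // w Ew; rewrite /P -!/d in Ew *.
  by have := tri x w q; move: yqx; rewrite (dC y x) (dC q x) (dC w q); lia.
have [le_q|gt_q] := leqP (2 * (d b y - D) + d x z) (d x y + d y z).
- (* The two ends of the detour are close to different sides.  It turns back
     towards y at distance t from z: either t = 0 and the jump from c to c' is
     trivial, or c is too far from the ball P for the jump to reach P. *)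
  pose t := (d z x - (d x a + 1 + D))%N.
  have [c zc cx] : exists2 c, d z c = t & (d c x = d z x - t)%N.
    by apply: dist_interpolate => //; exact: leq_subr.
  have [c' zc' c'y] : exists2 c', d z c' = t & (d c' y = d z y - t)%N.
    apply: dist_interpolate => //; rewrite /t -!/d.
    by have := tri x z y; have := tri z x y;
       rewrite (dC z x) (dC z y); have := tri x y z; lia.
  have t_le : (2 * t + d x y <= d z x + d z y)%N.
    by have := tri x z y; rewrite /t (dC z x) (dC z y); lia.
  have cc' : (d c c' <= D)%N.
    by apply: (thin (x := z) (y := x) (z := y)); rewrite ?zc ?zc' //;
       have := tri z y x; rewrite ?(dC y x); have := tri x z y;
       rewrite ?(dC x z); lia.
  have [p' xp' p'c] : exists2 p', d x p' = d x p & (d p' c = d x c - d x p)%N.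
    apply: dist_interpolate => //; rewrite -!/d (dC x c).
    by have := tri x z y; have := tri x y z; rewrite (dC z y) (dC x z) in le_p *;
       lia.
  have [q' yq' q'c'] : exists2 q', d y q' = d y q & (d q' c' = d y c' - d y q)%N.
    apply: dist_interpolate => //; rewrite -!/d (dC y c').
    by have := tri x z y; rewrite (dC y z) (dC x z) in le_q *; lia.
  have pc_le : (d x p <= d x c)%N.
    by rewrite (dC x c); have := tri x z y; have := tri x y z;
       rewrite (dC z y) (dC x z) in le_p *; lia.
  have yq_le : (d y q <= d y c')%N.
    by rewrite (dC y c'); rewrite (dC y z) (dC x z) in le_q *; lia.
  have xp'z : (d x p' + d p' z = d x z)%N.
    have := tri x p' z; have := tri p' c z.
    by rewrite (dC c z) (dC x c) (dC x z) in p'c pc_le *; lia.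
  have yq'z : (d y q' + d q' z = d y z)%N.
    have := tri y q' z; have := tri q' c' z.
    by rewrite (dC c' z) (dC y c') (dC y z) in q'c' yq_le *;
       have := tri z y x; rewrite (dC y x); lia.
  have pp' : (d p p' <= D)%N.
    by apply: (thin (x := x) (y := y) (z := z)) => //; lia.
  have qq' : (d q q' <= D)%N.
    by apply: (thin (x := y) (y := x) (z := z)) => //; rewrite (dC y x); lia.
  have r_p'c : reach (cut_step G F P) (d p' c) p' c.
    apply: (reach_unseen Gconn _ unsx); rewrite -!/d.
    by rewrite (dC c z) (dC x c) (dC x z) in p'c pc_le *; lia.
  have r_c'q' : reach (cut_step G F P) (d c' q') c' q'.
    apply: (reach_unseen Gconn _ unsy); rewrite -!/d.
    have := tri z y x; rewrite (dC y x).
    by rewrite (dC c' q') (dC q' y); rewrite (dC y c') in q'c' yq_le; lia.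
  have r_cc' : reach (cut_step G F P) D c c'.
    apply: (reach_le cc'); apply: reach_const => // w Ew; rewrite /P -!/d in Ew *.
    have := tri x w c; have := tri x c w; have := tri c z c'.
    by rewrite (dC w c) (dC x c) (dC c z); lia.
  have p'c_le : (d p' c <= 2 * D + 1)%N.
    by rewrite (dC x c) in p'c; lia.
  have c'q'_le : (d c' q' <= 7 * D + 2)%N.
    have := tri c' c q'; have := tri c p' q'; have := tri p' p q'.
    have := tri p a q'; have := tri a b q'; have := tri b q q'.
    by rewrite (dC c' c) (dC c p') (dC p' p) (dC b q); lia.
  have r := reach_trans r_ap (reach_trans (r_pp' _ xp' pp') (reach_trans r_p'c
    (reach_trans r_cc' (reach_trans r_c'q' (reach_trans (r_qq' _ qq' _) r_qb))))).
  apply: reach_le (r _); first by lia.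
  by have := tri q y q'; rewrite (dC q y); lia.
(* Both ends of the detour are close to the side xz. *)
have xq : (d x q + d y q = d x y)%N by move: yqx; rewrite (dC y x) (dC q x); lia.
have xq_le : (d x q <= d x z)%N by have := tri x z y; rewrite (dC z y); lia.
have pq_le : (d x p <= d x q)%N by lia.
have [q' xq' q'z] : exists2 q', d x q' = d x q & (d q' z = d x z - d x q)%N.
  exact: dist_interpolate.
have [p' xp' p'q'] : exists2 p', d x p' = d x p &
    (d p' q' = d x q' - d x p)%N.
  by apply: dist_interpolate; rewrite // -!/d xq'.
have xp'z : (d x p' + d p' z = d x z)%N.
  by have := tri x p' z; have := tri p' q' z; lia.
have pp' : (d p p' <= D)%N.
  by apply: (thin (x := x) (y := y) (z := z)) => //; lia.
have qq' : (d q q' <= D)%N.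
  by apply: (thin (x := x) (y := y) (z := z)) => //; rewrite ?(dC q y); lia.
have r_p'q' : reach (cut_step G F P) (d p' q') p' q'.
  by apply: (reach_unseen Gconn _ unsx); rewrite -!/d; lia.
have r := reach_trans r_ap (reach_trans (r_pp' _ xp' pp')
  (reach_trans r_p'q' (reach_trans (r_qq' _ qq' _) r_qb))).
by apply: reach_le (r _); have := tri x y z; lia.
Qed.

(** If [p] is beyond the internal point of the side [xy], then the point [q] at
distance [D] after [b] is beyond it too, and the reversed triangle satisfies the
hypothesis of [no_cut_triangle]. *)
Lemma unseen_triangle a b x y z :
  let F := short_arc_edges G a b (14 * D + 3) `|`
           short_arc_edges G b a (14 * D + 3) in
  adj G a b -> unseen_set G F (mkupair x z) -> unseen_set G F (mkupair z y) ->
  (d x a + 1 + d b y <> d x y)%N.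
Proof.
move=> F ab unsx unsy Exy.
have dC u v : d u v = d v u := distC Gconn u v.
have [le_p|gt_p] := leqP (2 * (d x a - D) + d y z) (d x y + d x z).
  apply: (no_cut_triangle ab Exy _ _ le_p) => f Ff;
    by [apply: unsx; left|apply: unsy; left].
have ba : adj G b a by rewrite adj_sym.
apply: (no_cut_triangle (x := y) (y := x) (z := z) ba).
- by rewrite (dC y b) (dC a x) (dC y x); lia.
- by rewrite mkupairC => f Ff; apply: unsy; right.
- by rewrite mkupairC => f Ff; apply: unsx; right.
- rewrite (dC y b) (dC y x).
  have := dist_triangle Gconn z x y; rewrite -!/d (dC z y); lia.
Qed.

End Triangles.

Theorem proposition5p3p1 (R : realType) (delta : R) (V : choiceType)
    (G : graph V) :
  connected G -> hyperbolic G delta -> fine G -> alternatively_hyperbolic G.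
Proof.
move=> Gconn hyp fG; have [D thin] := hyperbolic_fellow_travel Gconn hyp.
apply/alternatively_hyperbolicP => _ [a [b [ab ->]]].
pose N := (14 * D + 3)%N.
exists (short_arc_edges G a b N `|` short_arc_edges G b a N); split.
- by rewrite finite_setU; split; exact: finite_short_arc_edges.
- by move=> f [] /short_arc_edges_sub.
- move=> _ [x [y [z [-> unsx unsy]]]].
  apply/(unseen_distP Gconn _ _ ab); split.
    exact: (unseen_triangle Gconn thin ab unsx unsy).
  apply: (unseen_triangle Gconn thin (z := z)).
  + by rewrite adj_sym.
  + by rewrite setUC.
  + by rewrite setUC.
Qed.
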